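(* For all integers $r,n$ with $2\leq r<n$, $$\rho(S_{n,r})=\frac{r-2+\sqrt{(r-2)^2+4(r-1)(n-r+1)}}{2}.$$
   Context: All graphs are finite and undirected, with no loops or multiple edges. For $2\le r<n$, $S_{n,r}$ is the $n$-vertex graph obtained from a copy of the complete graph $K_{r-1}$ with vertex set $S$ by adding $n-r+1$ vertices, each of which has neighborhood exactly $S$. The spectral radius $\rho(G)$ of a graph $G$ is the largest eigenvalue $\lambda_1(G)$ of its adjacency matrix. *)

(* Defs.v *)
From HB Require Import structures.
From mathcomp Require Import all_boot all_order all_algebra spectral sesquilinear.
From mathcomp Require Import polyrcf complex zify.

Set Implicit Arguments.
Unset Strict Implicit.
Unset Printing Implicit Defensive.

Import Order.TTheory GRing.Theory Num.Theory.
Local Open Scope ring_scope.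

Record sgraph := SGraph {
  vertex : finType;
  edge : rel vertex;
  edge_sym : symmetric edge;
  edge_irrefl : irreflexive edge
}.

Definition adjmx (R : nzRingType) (G : sgraph) : 'M[R]_#|vertex G| :=
  \matrix_(i, j) (edge (enum_val i) (enum_val j))%:R.

(* [rootsR p] is the increasing list of the roots in [R] of [p != 0], so the
   eigenvalues are listed in increasing order, without multiplicity. *)
Definition eigenvalues (R : rcfType) n (A : 'M[R]_n) : seq R :=
  rootsR (char_poly A).

(* The largest eigenvalue; the default value 0 is only reached by the graph
   without vertices (see [spectral_radiusP]). *)
Definition spectral_radius (R : rcfType) (G : sgraph) : R :=
  last 0 (eigenvalues (adjmx R G)).

(* The summand 'I_(r - 1) is S; the other one is the set of added vertices. *)
Definition S_edge (n r : nat) : rel ('I_(r - 1) + 'I_(n - r + 1))%type :=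
  fun x y => match x, y with
  | inl i, inl j => i != j
  | inl _, inr _ | inr _, inl _ => true
  | inr _, inr _ => false
  end.

Lemma S_edge_sym n r : symmetric (@S_edge n r).
Proof. by case=> [i|i] [j|j] //=; rewrite eq_sym. Qed.

Lemma S_edge_irrefl n r : irreflexive (@S_edge n r).
Proof. by case=> [i|i] //=; rewrite eqxx. Qed.

Definition S_graph (n r : nat) : sgraph :=
  SGraph (@S_edge_sym n r) (@S_edge_irrefl n r).

Lemma card_S_graph n r :
  (2 <= r)%N -> (r < n)%N -> #|vertex (S_graph n r)| = n.
Proof.
by move=> r2 rn; rewrite card_sum !card_ord; lia.
Qed.

Lemma mem_eigenvalues (R : rcfType) n (A : 'M[R]_n) x :
  (x \in eigenvalues A) = eigenvalue A x.
Proof.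
have /roots_on_rootsR/(_ x) := monic_neq0 (char_poly_monic A).
by rewrite in_itv /= eigenvalue_root_char => ->.
Qed.

Lemma eigenvalues_sorted (R : rcfType) n (A : 'M[R]_n) :
  sorted <%R (eigenvalues A).
Proof. exact: sorted_roots. Qed.

Lemma symmetric_has_eigenvalue (R : rcfType) n (A : 'M[R]_n) :
  (0 < n)%N -> A^T = A -> exists x, eigenvalue A x.
Proof.
move=> n0 sA; pose f := real_complex R; pose B := map_mx f A.
have [a /eigenvalueP[v vB v0]] := eigenvalue_closed B n0.
pose w := map_mx Num.conj v.
have wB : B *m w^T = Num.conj a *: w^T.
  have BT : B^T = B by rewrite /B map_trmx sA.
  have Bc : map_mx Num.conj B = B.
    by apply/matrixP=> i j; rewrite !mxE /f; apply: conjc_real.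
  by rewrite -{1}BT -trmx_mul -{1}Bc -map_mxM vB map_mxZ linearZ.
have : v *m B *m w^T = v *m (B *m w^T) by rewrite mulmxA.
rewrite vB wB -scalemxAl -scalemxAr => /matrixP/(_ 0 0); rewrite !mxE.
set s := \sum_i _ => E.
have s0 : s != 0.
  apply/eqP => /eqP; rewrite /s psumr_eq0 => [/allP h|i _].
    case/eqP: v0; apply/rowP => i; rewrite mxE.
    have := h i (mem_index_enum _); rewrite !mxE /= -normCK expf_eq0 /=.
    by rewrite normr_eq0 => /eqP.
  by rewrite !mxE -normCK exprn_ge0.
have /eqP ca : Num.conj a = a by apply: (mulIf s0); rewrite -E.
have /complex_realP[k ak] : a \is Num.real by rewrite CrealE.
exists k; rewrite eigenvalue_root_char -(fmorph_root f) map_char_poly.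
rewrite -eigenvalue_root_char; apply/eigenvalueP; exists v => //.
by rewrite vB ak.
Qed.

Lemma adjmx_sym (R : rcfType) (G : sgraph) : (adjmx R G)^T = adjmx R G.
Proof. by apply/matrixP=> i j; rewrite !mxE edge_sym. Qed.

Lemma spectral_radiusP (R : rcfType) (G : sgraph) :
  (0 < #|vertex G|)%N ->
  eigenvalue (adjmx R G) (spectral_radius R G) /\
  forall x, eigenvalue (adjmx R G) x -> x <= spectral_radius R G.
Proof.
move=> G0; have [x0] := symmetric_has_eigenvalue G0 (adjmx_sym R G).
rewrite -!mem_eigenvalues /spectral_radius => h0.
have S := eigenvalues_sorted (adjmx R G).
have M y := mem_eigenvalues (adjmx R G) y.
case E: (eigenvalues _) h0 S M => [|a s] //= _ S M; split.
  by rewrite mem_last.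
move=> x; rewrite -M => xs.
have {S} : sorted <=%R (a :: s).
  by have : sorted <%R (a :: s) by []; rewrite lt_sorted_uniq_le => /andP[].
case/lastP: s {M E} xs => [|s b]; first by rewrite inE => /eqP->.
rewrite last_rcons -rcons_cons mem_rcons inE => /predU1P[->//|xs].
rewrite (sorted_pairwise le_trans) pairwise_rcons => /andP[/allP h _].
exact: h.
Qed.

(* Main.v *)
(* The quotient of the adjacency matrix by the partition of the vertices into S
   and its complement is 2 x 2, and the right-hand side is the positive root l
   of its characteristic equation l^2 = (r - 2) l + (r - 1)(n - r + 1).  Giving
   weight l to S and r - 1 to the other vertices yields a positive eigenvector
   for l, and a positive eigenvector of a nonnegative matrix always belongs to
   the largest eigenvalue. *)
Require Import Defs.
From mathcomp Require Import all_boot all_order all_algebra.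
From mathcomp Require Import ring lra.

Import Order.TTheory GRing.Theory Num.Theory.
Local Open Scope ring_scope.

Lemma eigenvalue_le_of_pos_eigenvector {R : realFieldType} {n : nat}
    {A : 'M[R]_n} {w : 'rV[R]_n} {l x : R} :
  (forall i j, 0 <= A i j) -> (forall i, 0 < w 0 i) -> w *m A = l *: w ->
  eigenvalue A x -> x <= l.
Proof.
move=> A0 w0 wA /eigenvalueP[v vA /rV0Pn[i0 vi0]].
(* Compare both eigenvector equations at a coordinate maximizing |v_i| / w_i. *)
case: (@Order.TotalTheory.arg_maxP _ _ _ i0 predT
         (fun i => `|v 0 i| / w 0 i)) => // i _ imax.
set m := `|v 0 i| / w 0 i in imax.
have vle j : `|v 0 j| <= m * w 0 j by rewrite -ler_pdivrMr //; apply: imax.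
have vi : `|v 0 i| = m * w 0 i by rewrite divfK // gt_eqF.
have vi_gt0 : 0 < `|v 0 i|.
  rewrite vi mulr_gt0 //; apply: lt_le_trans (imax i0 isT).
  by rewrite divr_gt0 ?normr_gt0.
rewrite -(ler_pM2r vi_gt0); apply: le_trans (_ : `|x * v 0 i| <= _).
  by rewrite normrM ler_wpM2r ?ler_norm.
have /rowP/(_ i) := vA; have /rowP/(_ i) := wA; rewrite !mxE => wAi <-.
(* Since [A] is nonnegative and [vle] bounds each [|v_j|], the sum of [v_j A_ji] is at most [m]
   times that of [w_j A_ji], in absolute value. *)
rewrite vi mulrCA -wAi mulr_sumr; apply: le_trans (ler_norm_sum _ _ _) _.
apply: ler_sum => j _.
by rewrite normrM (ger0_norm (A0 _ _)) mulrA ler_wpM2r.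
Qed.

(** Reindexing from ordinals to vertices lets the sum for [S_graph] be split along its two
    summands. *)
Lemma mul_adjmxE {R : nzRingType} (G : sgraph) (f : vertex G -> R) i :
  ((\row_j f (enum_val j)) *m adjmx R G) 0 i =
  \sum_x f x * (edge x (enum_val i))%:R.
Proof.
rewrite mxE [RHS](big_enum_val (fun x => f x * (edge x (enum_val i))%:R)).
by apply: eq_bigr => j _; rewrite !mxE.
Qed.

Lemma S_graph_eigenvector {R : comNzRingType} {r n : nat} {l : R} :
    (2 <= r)%N -> (r < n)%N ->
    l ^+ 2 = (r%:R - 2) * l + (r%:R - 1) * (n%:R - r%:R + 1) ->
  let w : 'rV_#|vertex (S_graph n r)| :=
    \row_j (if enum_val j is inl _ then l else r%:R - 1) in
  w *m adjmx R (S_graph n r) = l *: w.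
Proof.
move=> hr hrn hl w; apply/rowP => i.
rewrite (mul_adjmxE (S_graph n r)
  (fun x : vertex (S_graph n r) => if x is inl _ then l else r%:R - 1)).
rewrite !mxE big_sumType /=.
case: (enum_val i) => a /=; last first.
  (* An added vertex sees only the [r - 1] vertices of S, each of weight [l]. *)
  rewrite [X in _ + X]big1 => [|b _]; last by rewrite mulr0.
  rewrite addr0 sumr_const card_ord mulr1.
  by rewrite -[l *+ _]mulr_natr natrB // (ltnW hr).
(* A vertex of S sees [r - 2] others of weight [l] and all [n - r + 1] added ones of weight [r - 1];
   the total is [l ^+ 2] by [hl]. *)
under [X in _ + X]eq_bigr do rewrite mulr1.
rewrite sumr_const card_ord (bigD1 a) //= eqxx mulr0 add0r.
under eq_bigr => b ba do rewrite ba mulr1.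
rewrite sumr_const cardC1 card_ord -subn1 -subnDA addn1.
rewrite -[l *+ _]mulr_natr -[_ *+ (n - r + 1)]mulr_natr natrD.
rewrite !natrB //; last exact: ltnW.
by rewrite -expr2 hl mulrC.
Qed.

Theorem proposition1p4 (R : rcfType) (r n : nat) (hr : (2 <= r)%N)
    (hrn : (r < n)%N) :
  spectral_radius R (S_graph n r) =
  (r%:R - 2 + Num.sqrt ((r%:R - 2) ^+ 2 + 4 * (r%:R - 1) * (n%:R - r%:R + 1)))
  / 2.
Proof.
set D := _ + 4 * _ * _; set l := RHS.
have r2 : 2 <= r%:R :> R by rewrite (ler_nat R 2).
have rn : r%:R < n%:R :> R by rewrite ltr_nat.
have D0 : 0 < D by rewrite ltr_wpDl ?sqr_ge0 // !mulr_gt0 //; lra.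
(* For [r = 2] the first summand vanishes, so strictness comes from the square root. *)
have l0 : 0 < l.
  by rewrite divr_gt0 // ltr_wpDl ?sqrtr_gt0 // subr_ge0.
have hl : l ^+ 2 = (r%:R - 2) * l + (r%:R - 1) * (n%:R - r%:R + 1).
  have sD : Num.sqrt D ^+ 2 = D by rewrite sqr_sqrtr // ltW.
  have -> : l ^+ 2 = ((r%:R - 2) ^+ 2 + 2 * (r%:R - 2) * Num.sqrt D
                      + Num.sqrt D ^+ 2) / 4 by rewrite /l; field.
  by rewrite sD {2}/D /l; field.
have wA := S_graph_eigenvector hr hrn hl; set w := \row_j _ in wA.
have w0 j : 0 < w 0 j by rewrite mxE; case: (enum_val j) => // _; lra.
have A0 i j : 0 <= adjmx R (S_graph n r) i j by rewrite mxE ler0n.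
have V0 : (0 < #|vertex (S_graph n r)|)%N.
  by rewrite card_S_graph // (leq_ltn_trans _ hrn).
have [rho_eig rho_max] := spectral_radiusP R V0.
(* The upper bound applies to the spectral radius as an eigenvalue; conversely [w] makes [l] an
   eigenvalue. *)
apply: le_anti; rewrite (eigenvalue_le_of_pos_eigenvector A0 w0 wA rho_eig).
apply: rho_max; apply/eigenvalueP; exists w => //.
by apply/rV0Pn; exists (Ordinal V0); rewrite gt_eqF.
Qed.
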